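(* Let $S\subset\mathbb{Z}^2$ be a realizable set. Then there exist two non-equivalent realizations of $S$ if and only if at least one of the following conditions holds for some integers $\alpha,\beta$: (1) $\{(\alpha,\beta),(\alpha,\beta+1),(\alpha+1,\beta)\}\subset S$; (2) $\{(\alpha,\beta),(\alpha,\beta+1),(\alpha+1,\beta+1)\}\subset S$; (3) $\{(\alpha,\beta),(\alpha+1,\beta),(\alpha+1,\beta+1)\}\subset S$; (4) $\{(\alpha-1,\beta),(\alpha,\beta-1),(\alpha,\beta+1),(\alpha+1,\beta)\}\subset S$; (5) $\{(\alpha,\beta),(\alpha,\beta+2),(\alpha+1,\beta+1),(\alpha+2,\beta)\}\subset S$.
   Context: All graphs are finite, simple and connected; $d$ is the shortest-path distance. For an ordered vertex subset $W=(\omega_1,\omega_2)$ of $G$, $r(u\vert W)=(d(u,\omega_1),d(u,\omega_2))$; $W$ is a resolving set if $r(\cdot\vert W)$ is injective on $V(G)$. $(G,W)$ is a realization of $S\subset\mathbb{Z}^2$ if $W$ is a resolving set of $G$ and $S=\{r(u\vert W)\colon u\in V(G)\}$; $S$ is realizable if it has a realization. Two realizations $(G,W)$ and $(G',W')$ of $S$ are equivalent if the map $f\colon V(G)\to V(G')$ determined by $r(u\vert W)=r(f(u)\vert W')$ is a graph isomorphism. *)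

(* Defs.v *)
From mathcomp Require Import all_boot all_order all_algebra.
From mathcomp Require Import boolp classical_sets.

Set Implicit Arguments.
Unset Strict Implicit.
Unset Printing Implicit Defensive.

Import Order.TTheory GRing.Theory Num.Theory.

Local Open Scope classical_set_scope.
Local Open Scope ring_scope.

Record graph := Graph {
  vertex :> finType;
  adj : rel vertex;
  adj_sym : symmetric adj;
  adj_irr : irreflexive adj;
  adj_connected : forall x y : vertex, connect adj x y
}.

Definition walk (G : graph) (x y : G) (n : nat) : bool :=
  [exists p : n.-tuple G, path (@adj G) x p && (last x p == y)].

Lemma walk_exists (G : graph) (x y : G) : exists n, walk x y n.
Proof.
have /connectP [p xp ->] := adj_connected x y.
by exists (size p); apply/existsP; exists (in_tuple p); rewrite /= xp eqxx.
Qed.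

(* Repeated vertices are allowed in a walk; a shortest walk is always a simple
   path, so this is the shortest-path distance. *)
Definition dist (G : graph) (x y : G) : nat := ex_minn (walk_exists x y).

Definition code (G : graph) (W : G * G) (u : G) : int * int :=
  (Posz (dist u W.1), Posz (dist u W.2)).

Definition resolving (G : graph) (W : G * G) : Prop := injective (code W).

(* The components of W are required to be distinct because W is an ordered
   two-element vertex subset. *)
Definition realization (S : set (int * int)) (G : graph) (W : G * G) : Prop :=
  [/\ W.1 != W.2, resolving W & S = range (code W)].

Definition realizable (S : set (int * int)) : Prop :=
  exists (G : graph) (W : G * G), realization S W.

Definition graph_iso (G G' : graph) (f : G -> G') : Prop :=
  bijective f /\ {mono f : x y / adj x y}.

(* When (G, W) and (G', W') realize the same set, exactly one map f satisfies
   the first condition, so the existential quantifier selects that map. *)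
Definition equivalent (G G' : graph) (W : G * G) (W' : G' * G') : Prop :=
  exists f : G -> G', (forall u, code W u = code W' (f u)) /\ graph_iso f.

(* Main.v *)
Require Import Defs.
From mathcomp Require Import all_boot all_order all_algebra.
From mathcomp Require Import boolp classical_sets.
From mathcomp Require Import zify.

(** View the vertices of a realization as points of [S].  Edges can only join
    points at king distance one, and a set of such edges defines a realization
    as soon as every vertex other than [w1] (resp. [w2]) has a neighbour whose
    first (resp. second) coordinate is one less.  This requirement is monotone,
    so the full king graph is a realization, and [S] has a second one iff some
    king edge can be dropped.  An edge can be dropped iff each end that uses it
    to descend has another neighbour to descend to; listing the horizontal,
    vertical and two diagonal edge directions yields the five configurations. *)

Set Implicit Arguments.
Unset Strict Implicit.
Unset Printing Implicit Defensive.

Import Order.TTheory GRing.Theory Num.Theory.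

Local Open Scope classical_set_scope.
Local Open Scope ring_scope.

(** * Distance functions characterised by local conditions *)

Lemma dist_le_size (G : graph) (x : G) (p : seq G) :
  path (@adj G) x p -> (dist x (last x p) <= size p)%N.
Proof.
move=> xp; rewrite /dist; case: ex_minnP => n _; apply.
by apply/existsP; exists (in_tuple p); rewrite /= xp eqxx.
Qed.

Lemma geodesic (G : graph) (x y : G) :
  exists p, [/\ path (@adj G) x p, last x p = y & size p = dist x y].
Proof.
rewrite /dist; case: ex_minnP => n /existsP [p /andP [xp /eqP py]] _.
by exists p; rewrite size_tuple.
Qed.

Lemma dist_eq0 (G : graph) (x y : G) : (dist x y == 0%N) = (x == y).
Proof.
apply/eqP/eqP => [d0|->].
  by have [[|z p] [_ /= xy]] := geodesic x y; rewrite d0.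
by apply/eqP; rewrite -leqn0; apply: (@dist_le_size _ y [::]).
Qed.

Lemma dist_adj (G : graph) (w u v : G) :
  adj u v -> (dist u w <= (dist v w).+1)%N.
Proof.
move=> uv; have [p [vp <- <-]] := geodesic v w.
by apply: (@dist_le_size _ u (v :: p)); rewrite /= uv.
Qed.

Definition descending (V : finType) (e : rel V) (f : V -> nat) (w : V) : Prop :=
  forall u, u != w -> exists2 v, e u v & f u = (f v).+1.

Lemma dist_descending (G : graph) (w : G) :
  descending (@adj G) (fun u => dist u w) w.
Proof.
move=> u; rewrite -dist_eq0.
have [[|v p] [/= up pw sz]] := geodesic u w; first by rewrite -sz.
case/andP: up => uv vp _; exists v => //.
apply/eqP; rewrite eqn_leq dist_adj //= -sz ltnS -pw.
exact: dist_le_size.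
Qed.

Lemma descending_path (V : finType) (e : rel V) (f : V -> nat) (w u : V) :
  descending e f w -> exists p, [/\ path e u p, last u p = w & size p <= f u]%N.
Proof.
move=> desc; have [n] := ubnP (f u); elim: n u => // n IHn u fun_.
have [->|uw] := eqVneq u w; first by exists [::].
have [v uv fuv] := desc u uw.
have [|p [vp pw sz]] := IHn v; first by lia.
by exists (v :: p); rewrite /= uv vp; split=> //; lia.
Qed.

(** Descending along [f] gives a walk to [w] of length at most [f u]. Conversely, [f] loses at most
    one per step of a geodesic and ends at 0, so no walk is shorter. *)
Lemma dist_unique (G : graph) (f : G -> nat) (w : G) :
  f w = 0%N -> (forall u v, adj u v -> (f u <= (f v).+1)%N) ->
  descending (@adj G) f w -> forall u, dist u w = f u.
Proof.
move=> fw lip desc u; apply/eqP; rewrite eqn_leq; apply/andP; split.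
  have [p [up <- sz]] := descending_path u desc.
  exact: leq_trans (dist_le_size up) sz.
have [p [up pw <-]] := geodesic u w.
elim: p u up pw => [|v p IHp] u /=; first by move=> _ ->; rewrite fw.
case/andP=> /lip uv vp pw; apply: leq_trans uv _.
by rewrite ltnS; apply: IHp.
Qed.

(** * Subgraphs of the king graph as realizations *)

Definition king (G : graph) (W : G * G) : rel G := fun u v =>
  [&& u != v,
      (dist u W.1 <= (dist v W.1).+1)%N, (dist v W.1 <= (dist u W.1).+1)%N,
      (dist u W.2 <= (dist v W.2).+1)%N & (dist v W.2 <= (dist u W.2).+1)%N].

Lemma king_sym (G : graph) (W : G * G) : symmetric (king W).
Proof. by move=> u v; rewrite /king eq_sym; congr andb; lia. Qed.

Lemma adj_king (G : graph) (W : G * G) (u v : G) : adj u v -> king W u v.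
Proof.
move=> uv; have vu : adj v u by rewrite adj_sym.
rewrite /king !dist_adj // !andbT.
by apply/eqP => E; rewrite E adj_irr in uv.
Qed.

(** The king inequalities make the old distances 1-Lipschitz along [e], so by [dist_unique] they
    remain the distances of the new graph. Connectedness comes from descending to [W.1]. *)
Lemma realization_subking (S : set (int * int)) (G : graph) (W : G * G)
    (e : rel G) :
  realization S W -> symmetric e -> subrel e (king W) ->
  descending e (fun u => dist u W.1) W.1 ->
  descending e (fun u => dist u W.2) W.2 ->
  exists (e_sym : symmetric e) (e_irr : irreflexive e)
         (e_conn : forall x y : G, connect e x y),
    let G' := Graph e_sym e_irr e_conn in
    realization S (W : G' * G') /\ forall u : G, code (W : G' * G') u = code W u.
Proof.
move=> [W12 res SE] e_sym sub_e desc1 desc2.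
have e_irr : irreflexive e.
  by move=> u; apply/negP => /sub_e; rewrite /king eqxx.
have to_w u : connect e u W.1.
  have [p [up <- _]] := descending_path u desc1.
  by apply/connectP; exists p.
have e_conn x y : connect e x y.
  apply: connect_trans (to_w x) _.
  by rewrite (sym_connect_sym e_sym); apply: to_w.
exists e_sym, e_irr, e_conn => G'.
have codeE (u : G) : code (W : G' * G') u = code W u.
  rewrite /code; congr (Posz _, Posz _);
    apply: (@dist_unique G' (fun u : G => dist u _)) => //;
    first [by apply/eqP; rewrite dist_eq0
          | by move=> x y /= /sub_e /and5P []].
split=> //; split=> //.
- by move=> x y; rewrite !codeE; apply: res.
- rewrite SE; apply/seteqP; split=> _ [u _ <-]; exists u => //; exact: codeE.
Qed.

(** * Dropping one king edge *)

(** Expresses that [q] can do without [p] when descending to [w]; vacuous if [p] is not one level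
    below [q]. *)
Definition alternative (G : graph) (W : G * G) (w p q : G) : Prop :=
  dist q w = (dist p w).+1 ->
  exists p', [/\ p' != p, king W q p' & dist p' w = dist p w].

Definition edge (V : eqType) (p q : V) : rel V :=
  fun u v => (u == p) && (v == q) || (u == q) && (v == p).

Lemma edgeC (V : eqType) (p q u v : V) : edge p q u v = edge q p u v.
Proof. by rewrite /edge orbC. Qed.

Lemma edge_sym (V : eqType) (p q : V) : symmetric (edge p q).
Proof. by move=> u v; rewrite edgeC /edge ![in RHS](andbC (v == _)). Qed.

Definition drop_edge (V : eqType) (e : rel V) (p q : V) : rel V :=
  fun u v => e u v && ~~ edge p q u v.

Lemma descending_drop_edge (G : graph) (W : G * G) (w p q : G) :
  alternative W w p q -> alternative W w q p ->
  descending (drop_edge (king W) p q) (fun u => dist u w) w.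
Proof.
move=> altp altq u uw.
have drop (p0 q0 p' : G) : p' != p0 -> king W q0 p' -> ~~ edge p0 q0 q0 p'.
  move=> p'p0 /and5P [q0p' _ _ _ _].
  by rewrite /edge (negPf p'p0) [p' == _]eq_sym (negPf q0p') !andbF.
(* The original graph already provides a descent; it needs replacing only if it runs along the
   dropped edge. *)
have [v uv duv] := dist_descending uw.
have [|Nuv] := boolP (edge p q u v); last first.
  by exists v => //; rewrite /drop_edge adj_king.
case/orP=> /andP [/eqP ? /eqP ?]; subst u v.
- have [q' [q'q pq' dq']] := altq duv.
  by exists q'; rewrite ?dq' // /drop_edge pq' edgeC drop.
- have [p' [p'p qp' dp']] := altp duv.
  by exists p'; rewrite ?dp' // /drop_edge qp' drop.
Qed.

Definition flexible (S : set (int * int)) : Prop :=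
  exists (G : graph) (W : G * G) (G' : graph) (W' : G' * G'),
    [/\ realization S W, realization S W' & ~ equivalent W W'].

(** The two realizations are the full king graph and the king graph without [p q]. They share
    vertices and codes, so a code-preserving map is the identity, which does not preserve adjacency
    of [p] and [q]. *)
Lemma flexible_drop_edge (S : set (int * int)) (G : graph) (W : G * G)
    (p q : G) :
  realization S W -> king W p q ->
  alternative W W.1 p q -> alternative W W.1 q p ->
  alternative W W.2 p q -> alternative W W.2 q p -> flexible S.
Proof.
move=> rW pq alt1 alt1' alt2 alt2'; have [W12 res SE] := rW.
have [s1 [i1 [c1 [r1 code1]]]] := realization_subking rW (king_sym W)
  (fun _ _ => id) (fun u uw => let: ex_intro2 v uv d := dist_descending uw in
     ex_intro2 _ _ v (adj_king W uv) d)
  (fun u uw => let: ex_intro2 v uv d := dist_descending uw in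
     ex_intro2 _ _ v (adj_king W uv) d).
have sub2 : subrel (drop_edge (king W) p q) (king W) by move=> u v /andP [].
have sym2 : symmetric (drop_edge (king W) p q).
  by move=> u v; rewrite /drop_edge king_sym edge_sym.
have [s2 [i2 [c2 [r2 code2]]]] := realization_subking rW sym2 sub2
  (descending_drop_edge alt1 alt1') (descending_drop_edge alt2 alt2').
do 4 eexists; split; [exact: r1 | exact: r2 |].
case=> f [fcode [_ mono]].
have fE u : f u = u by apply: res; rewrite -code2 -fcode code1.
have /= := mono p q; rewrite !fE pq.
by rewrite /drop_edge /edge !eqxx andbF.
Qed.

(** * From a configuration to two realizations *)

Definition reducible (S : set (int * int)) : Prop :=
  exists a b : int,
        [set (a, b); (a, b + 1); (a + 1, b)] `<=` S
     \/ [set (a, b); (a, b + 1); (a + 1, b + 1)] `<=` S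
     \/ [set (a, b); (a + 1, b); (a + 1, b + 1)] `<=` S
     \/ [set (a - 1, b); (a, b - 1); (a, b + 1); (a + 1, b)] `<=` S
     \/ [set (a, b); (a, b + 2); (a + 1, b + 1); (a + 2, b)] `<=` S.

Lemma set3_sub (T : Type) (S : set T) (x y z : T) :
  [set x; y; z] `<=` S <-> [/\ S x, S y & S z].
Proof.
split=> [sub|[Sx Sy Sz] _ [[]|] ->] //.
by split; apply: sub; [left; left | left; right | right].
Qed.

Lemma set4_sub (T : Type) (S : set T) (x y z t : T) :
  [set x; y; z; t] `<=` S <-> [/\ S x, S y, S z & S t].
Proof.
split=> [sub|[Sx Sy Sz St] _ [[[]|]|] ->] //.
by split; apply: sub; [do 3 left | left; left; right | left; right | right].
Qed.

Lemma realizationP (S : set (int * int)) (G : graph) (W : G * G) (a b : int) :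
  realization S W ->
  S (a, b) <-> exists u, (dist u W.1)%:Z = a /\ (dist u W.2)%:Z = b.
Proof.
case=> _ _ ->; split=> [[u _ [<- <-]]|[u [<- <-]]]; by exists u.
Qed.

Lemma flexible_reducible (S : set (int * int)) :
  realizable S -> reducible S -> flexible S.
Proof.
move=> [G [W rW]] [a [b]]; rewrite !set3_sub !set4_sub.
have neq (u v : G) :
    (dist u W.1 != dist v W.1) || (dist u W.2 != dist v W.2) -> u != v.
  by apply: contraTneq => ->; rewrite !eqxx.
have pt a' b' := realizationP a' b' rW.
case=> [|[|[|[|]]]].
(* A horizontal or vertical edge lowers only one coordinate, so a single detour, the third point,
   suffices here and in the next two cases. *)
- case=> /pt [u [u1 u2]] /pt [v [v1 v2]] /pt [t [t1 t2]].
  apply: (@flexible_drop_edge S G W u t rW); try (by move=> ?; lia).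
    by rewrite /king neq; lia.
  by move=> _; exists v; split; rewrite /king ?neq; lia.
- case=> /pt [u [u1 u2]] /pt [v [v1 v2]] /pt [t [t1 t2]].
  apply: (@flexible_drop_edge S G W v t rW); try (by move=> ?; lia).
    by rewrite /king neq; lia.
  by move=> _; exists u; split; rewrite /king ?neq; lia.
- case=> /pt [u [u1 u2]] /pt [v [v1 v2]] /pt [t [t1 t2]].
  apply: (@flexible_drop_edge S G W v t rW); try (by move=> ?; lia).
    by rewrite /king neq; lia.
  by move=> _; exists u; split; rewrite /king ?neq; lia.
(* On the antidiagonal edge each end descends in one coordinate: [r] is rerouted to [d], and [u] to
   [l]. *)
- case=> /pt [l [l1 l2]] /pt [d [d1 d2]] /pt [u [u1 u2]] /pt [r [r1 r2]].
  apply: (@flexible_drop_edge S G W u r rW); try (by move=> ?; lia).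
  + by rewrite /king neq; lia.
  + by move=> _; exists d; split; rewrite /king ?neq; lia.
  + by move=> _; exists l; split; rewrite /king ?neq; lia.
(* On the diagonal edge [q] descends in both coordinates: [u] replaces [p] for the first, [r] for
   the second. *)
- case=> /pt [p [p1 p2]] /pt [u [u1 u2]] /pt [q [q1 q2]] /pt [r [r1 r2]].
  apply: (@flexible_drop_edge S G W p q rW); try (by move=> ?; lia).
  + by rewrite /king neq; lia.
  + by move=> _; exists u; split; rewrite /king ?neq; lia.
  + by move=> _; exists r; split; rewrite /king ?neq; lia.
Qed.

(** * From a missing king edge to a configuration *)

Lemma nonadj_detour (G : graph) (W : G * G) (w u v : G) :
  ~~ adj v u -> dist v w = (dist u w).+1 ->
  exists v', [/\ v' != u, king W v v' & dist v' w = dist u w].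
Proof.
move=> Nvu dvu; have vw : v != w by rewrite -dist_eq0 dvu.
have [v' vv' dv'] := dist_descending vw; exists v'; split; last by lia.
- by apply: contraNneq Nvu => <-.
- exact: adj_king.
Qed.

Lemma rigid_adj (S : set (int * int)) (G : graph) (W : G * G) (u v : G) :
  realization S W -> ~ reducible S -> adj u v = king W u v.
Proof.
move=> rW Nred; apply/idP/idP => [|kuv]; first exact: adj_king.
apply: contra_notT Nred => Nuv.
have [_ res _] := rW.
have neq (x y : G) : x != y ->
    (dist x W.1 != dist y W.1) || (dist x W.2 != dist y W.2).
  apply: contra_neqT; rewrite negb_or !negbK => /andP [/eqP E1 /eqP E2].
  by apply: res; rewrite /code E1 E2.
have mem a b x : (dist x W.1)%:Z = a -> (dist x W.2)%:Z = b -> S (a, b).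
  by move=> <- <-; apply/(realizationP _ _ rW); exists x.
(* Ordering the codes of [u] and [v] lexicographically leaves four directions for the missing
   edge. *)
wlog le_uv : u v kuv Nuv / (dist u W.1 < dist v W.1)%N \/
    dist u W.1 = dist v W.1 /\ (dist u W.2 < dist v W.2)%N.
  move=> wl; have /and5P [/neq uv _ _ _ _] := kuv.
  have [le|] := boolP ((dist u W.1 < dist v W.1)%N ||
    (dist u W.1 == dist v W.1) && (dist u W.2 < dist v W.2)%N).
    by apply: (wl u v) => //; lia.
  by move=> nle; apply: (wl v u); rewrite 1?king_sym 1?adj_sym //; lia.
have Nvu : ~~ adj v u by rewrite adj_sym.
have /and5P [_ k1 k2 k3 k4] := kuv.
rewrite /reducible.
case: le_uv => [lt1|[eq1 lt2]]; last first.
  (* Vertical edge: [t] lies level with [u], one step to its right or left. *)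
  have [|t [/neq tu /and5P [_ t1 t2 _ _] t3]] :=
    nonadj_detour W Nvu (w := W.2); first by lia.
  have [lt|ge] := ltnP (dist u W.1) (dist t W.1).
    exists (dist u W.1), (dist u W.2); left; apply/set3_sub.
    by split; [apply: (mem _ _ u) | apply: (mem _ _ v) | apply: (mem _ _ t)];
       lia.
  exists (dist t W.1), (dist t W.2); do 2 right; left; apply/set3_sub.
  by split; [apply: (mem _ _ t) | apply: (mem _ _ u) | apply: (mem _ _ v)]; lia.
have [|s [/neq su /and5P [_ _ _ s1 s2] s3]] :=
  nonadj_detour W Nvu (w := W.1); first by lia.
have [lt2|lt2|eq2] := ltngtP (dist u W.2) (dist v W.2).
(* Diagonal edge: [s] is one or two above [u], and [t] one or two to its right. Only when both are
   two away is the four-point configuration needed. *)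
- have [|t [/neq tu /and5P [_ t1 t2 _ _] t3]] :=
    nonadj_detour W Nvu (w := W.2); first by lia.
  exists (dist u W.1), (dist u W.2).
  have [sv|svN] := eqVneq (dist s W.2) (dist v W.2).
    right; left; apply/set3_sub.
    by split; [apply: (mem _ _ u) | apply: (mem _ _ s) | apply: (mem _ _ v)];
       lia.
  have [tv|tvN] := eqVneq (dist t W.1) (dist v W.1).
    do 2 right; left; apply/set3_sub.
    by split; [apply: (mem _ _ u) | apply: (mem _ _ t) | apply: (mem _ _ v)];
       lia.
  do 4 right; apply/set4_sub.
  by split; [apply: (mem _ _ u) | apply: (mem _ _ s) | apply: (mem _ _ v)
            | apply: (mem _ _ t)]; lia.
(* Antidiagonal edge: here [u] is the end that descends in the second coordinate. Either detour may
   hit the corner below [u] and left of [v]; if neither does, the four points surround it. *)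
- have [|t [/neq tv /and5P [_ t1 t2 _ _] t3]] :=
    nonadj_detour W Nuv (w := W.2); first by lia.
  exists (dist u W.1), (dist v W.2).
  have [sv|svN] := eqVneq (dist s W.2) (dist v W.2).
    left; apply/set3_sub.
    by split; [apply: (mem _ _ s) | apply: (mem _ _ u) | apply: (mem _ _ v)];
       lia.
  have [tu|tuN] := eqVneq (dist t W.1) (dist u W.1).
    left; apply/set3_sub.
    by split; [apply: (mem _ _ t) | apply: (mem _ _ u) | apply: (mem _ _ v)];
       lia.
  do 3 right; left; apply/set4_sub.
  by split; [apply: (mem _ _ t) | apply: (mem _ _ s) | apply: (mem _ _ u)
            | apply: (mem _ _ v)]; lia.
(* Horizontal edge: [s] is directly above or below [u]. *)
- have [lt|ge] := ltnP (dist u W.2) (dist s W.2).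
    exists (dist u W.1), (dist u W.2); left; apply/set3_sub.
    by split; [apply: (mem _ _ u) | apply: (mem _ _ s) | apply: (mem _ _ v)];
       lia.
  exists (dist s W.1), (dist s W.2); right; left; apply/set3_sub.
  by split; [apply: (mem _ _ s) | apply: (mem _ _ u) | apply: (mem _ _ v)]; lia.
Qed.

(** Both adjacencies are the king relation, which is determined by codes, so the code-matching
    bijection is an isomorphism. *)
Lemma rigid_equivalent (S : set (int * int)) (G G' : graph) (W : G * G)
    (W' : G' * G') :
  ~ reducible S -> realization S W -> realization S W' -> equivalent W W'.
Proof.
move=> Nred rW rW'; have [_ res SE] := rW; have [_ res' SE'] := rW'.
have code_in u : range (code W') (code W u) by rewrite -SE' SE; exists u.
have code_in' u : range (code W) (code W' u) by rewrite -SE SE'; exists u.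
have /choice [f fP] : forall u, exists v, code W' v = code W u.
  by move=> u; have [v _ <-] := code_in u; exists v.
have /choice [g gP] : forall v, exists u, code W u = code W' v.
  by move=> v; have [u _ <-] := code_in' v; exists u.
exists f; split=> [u|]; first by rewrite fP.
split=> [|x y].
  by exists g => u; [apply: res; rewrite gP fP | apply: res'; rewrite fP gP].
rewrite (rigid_adj x y rW Nred) (rigid_adj _ _ rW' Nred) /king.
have [[-> ->] [-> ->]] := (fP x, fP y); congr andb.
congr negb; apply/eqP/eqP => [E|->//].
by apply: res; rewrite -!fP E.
Qed.

Theorem theorem13 (S : set (int * int)) (S_realizable : realizable S) :
  (exists (G : graph) (W : G * G) (G' : graph) (W' : G' * G'),
     [/\ realization S W, realization S W' & ~ equivalent W W'])
  <->
  (exists a b : int,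
        [set (a, b); (a, b + 1); (a + 1, b)] `<=` S
     \/ [set (a, b); (a, b + 1); (a + 1, b + 1)] `<=` S
     \/ [set (a, b); (a + 1, b); (a + 1, b + 1)] `<=` S
     \/ [set (a - 1, b); (a, b - 1); (a, b + 1); (a + 1, b)] `<=` S
     \/ [set (a, b); (a, b + 2); (a + 1, b + 1); (a + 2, b)] `<=` S).
Proof.
split; last exact: flexible_reducible.
case=> G [W [G' [W' [rW rW' neqv]]]]; apply: contra_notP neqv => Nred.
exact: rigid_equivalent Nred rW rW'.
Qed.
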